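(* Let $X$ be an atomic Markov chain with accessible atom $A$, $\beta$-regular with $\beta\in(0,1)$, and with initial probability distribution $\nu$. Let $\delta\in(0,1/2)$, and let $H_\delta>R_\delta>0$ and $n_\delta$ be such that $$\mathbb{P}\left(\frac{M_\beta(1)}{\Gamma(1-\beta)}\in[R_\delta,H_\delta]\right)\geq 1-\frac{\delta}{2}\quad\text{and}\quad \mathbb{P}_\nu\left(N_n\in\left[\frac{R_\delta}{\overline F(n)},\frac{H_\delta}{\overline F(n)}\right]\right)>1-\delta\ \text{ for all } n\geq n_\delta .$$ Set $v_n(\delta)=\ln(36/\delta)\,\overline F(n)/H_\delta$. Then, as soon as $n\geq n_\delta$ and $p_{k+1}\geq (40H_\delta R_\delta^{-1})^2 v_n(\delta)$, one has, with $\mathbb{P}_\nu$-probability larger than $1-2\delta$, $$\left|\widehat\beta_{N_n}(k)-\beta\right|\leq\frac{60H_\delta}{R_\delta}\sqrt{\frac{v_n(\delta)}{p_{k+1}}}+\left|\ln\left(\frac{L(e^k)}{L(e^{k+1})}\right)\right|.$$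
   Context: $X=(X_n)_{n\in\mathbb{N}}$ is a time-homogeneous, $\psi$-irreducible, aperiodic, Harris recurrent Markov chain on a state space $E$ with countably generated $\sigma$-field $\mathcal{E}$ and transition probability $\Pi$; $\mathbb{P}_\nu$ is the law when $X_0\sim\nu$. An accessible atom is a set $A\in\mathcal{E}$ with $\psi(A)>0$ and $\Pi(x,\cdot)=\Pi(y,\cdot)$ for all $x,y\in A$; $\mathbb{P}_A$ is the law when $X_0\in A$. Let $\tau_A=\tau_A(1)=\inf\{n\geq1: X_n\in A\}$, $\tau_A(j)=\inf\{n>\tau_A(j-1): X_n\in A\}$ for $j\geq2$, and $S_j=\tau_A(j+1)-\tau_A(j)$. $N_n=\max(\sum_{i=1}^n\mathbb{I}\{X_i\in A\}-1,\,0)$ is the number of durations $S_j$ completely observed up to time $n$. Write $\overline F(x)=\mathbb{P}_A(\tau_A>x)$. For an atomic chain, being $\beta$-regular is equivalent to $\overline F(x)=x^{-\beta}L(x)$ with $L$ slowly varying, i.e. $L(\lambda z)/L(z)\to1$ as $z\to+\infty$ for all $\lambda>0$; here $L(x)=x^\beta\overline F(x)$ for real $x>0$. $M_\beta(1)$ has the Mittag-Leffler distribution with parameter $\beta$, i.e. $\mathbb{E}[M_\beta(1)^m]=m!/\Gamma(1+m\beta)$ for all integers $m\geq0$. For real $l$, $p_l=\mathbb{P}_A(\tau_A>e^l)$ and $\widehat p^{(N_n)}_l=\frac1{N_n}\sum_{i=1}^{N_n}\mathbb{I}\{S_i>e^l\}$ (for $N_n\geq 1$). The estimator is $\widehat\beta_{N_n}(k)=\ln(\widehat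 p^{(N_n)}_k/\widehat p^{(N_n)}_{k+1})$ when $\widehat p^{(N_n)}_{k+1}>0$ and $0$ otherwise. $k$ is a real number. *)

(* Defs.v *)
From HB Require Import structures.
From mathcomp Require Import all_boot all_order all_algebra.
From mathcomp Require Import all_classical all_reals all_analysis.

Set Implicit Arguments.
Unset Strict Implicit.
Unset Printing Implicit Defensive.

Import Order.TTheory GRing.Theory Num.Theory.
Import numFieldNormedType.Exports.

Local Open Scope classical_set_scope.
Local Open Scope ring_scope.

Definition countably_generated d (E : measurableType d) : Prop :=
  exists G : set (set E), countable G /\ (measurable : set (set E)) = <<s G >>.

Section transition_kernels.
Context d (E : measurableType d) (R : realType).
Implicit Types (Pi : R.-pker E ~> E) (psi : {measure set E -> \bar R}).

Fixpoint kernel_iter Pi (n : nat) (x : E) (B : set E) : \bar R :=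
  (if n is m.+1 then \int[Pi x]_y kernel_iter Pi m y B else \d_x B)%E.

(* psi is not required to be maximal among the irreducibility measures. *)
Definition psi_irreducible Pi psi : Prop :=
  [/\ sigma_finite setT psi, (0 < psi setT)%E &
      forall B, measurable B -> (0 < psi B)%E ->
      forall x, exists2 n, (0 < n)%N & (0 < kernel_iter Pi n x B)%E].

Definition cyclic_classes Pi psi (p : nat) (D : nat -> set E) : Prop :=
  [/\ forall i, (i < p)%N -> measurable (D i),
      forall i j, (i < p)%N -> (j < p)%N -> i != j -> D i `&` D j = set0,
      forall i, (i < p)%N -> forall x, D i x -> Pi x (D (i.+1 %% p)%N) = 1%E &
      psi (~` \bigcup_(i < p) D i) = 0%E].

(* The period of an irreducible chain is the largest number p of cyclic classes. *)
Definition aperiodic Pi psi : Prop :=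
  forall p D, cyclic_classes Pi psi p D -> (p <= 1)%N.

Definition accessible_atom Pi psi (A : set E) : Prop :=
  [/\ measurable A, (0 < psi A)%E &
      forall x y, A x -> A y -> forall B, measurable B -> Pi x B = Pi y B].

End transition_kernels.

Section chains.
Context d (E : measurableType d) d' (Omega : measurableType d') (R : realType).
Implicit Types (X : nat -> {mfun Omega >-> E}) (Pr : probability Omega R).

Definition past X (n : nat) : set (set Omega) :=
  <<s [set F | exists i B, [/\ (i <= n)%N, measurable B & F = X i @^-1` B]] >>.

(* The last clause says that Pi (X n) B is a version of the conditional
   probability of X n.+1 \in B given sigma(X 0, ..., X n). *)
Definition markov_chain Pr X (Pi : R.-pker E ~> E) (nu : probability E R) :
    Prop :=
  (forall B, measurable B -> Pr (X 0%N @^-1` B) = nu B) /\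
  (forall n F B, past X n F -> measurable B ->
    Pr (F `&` X n.+1 @^-1` B) = \int[Pr]_(w in F) Pi (X n w) B)%E.

(* P nu is the law under which X 0 has distribution nu. *)
Definition harris_recurrent X (P : probability E R -> probability Omega R)
    (psi : {measure set E -> \bar R}) : Prop :=
  forall B, measurable B -> (0 < psi B)%E ->
  forall x, P \d_x (lim_sup_set (fun n => X n @^-1` B)) = 1%E.

Variables (X : nat -> {mfun Omega >-> E}) (A : set E).

(* tau 0 = 0 is a convention: tau j.+1 is the first visit to A strictly after
   tau j, so tau 1 is the first visit at a time >= 1; it is +oo if there is
   no such visit. *)
Fixpoint tau (j : nat) (w : Omega) : \bar R :=
  if j is i.+1 then
    ereal_inf [set n%:R%:E | n in [set n : nat |
      (tau i w < n%:R%:E)%E /\ A (X n w)]]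
  else 0%E.

Definition duration (j : nat) (w : Omega) : \bar R := (tau j.+1 w - tau j w)%E.

(* The subtraction is truncated. *)
Definition num_durations (n : nat) (w : Omega) : nat :=
  (\sum_(1 <= i < n.+1) (X i w \in A) - 1)%N.

(* Equal to 0 when N = 0, as 0^-1 = 0. *)
Definition p_hat (N : nat) (l : R) (w : Omega) : R :=
  N%:R^-1 * \sum_(1 <= i < N.+1) ((expR l)%:E < duration i w)%E%:R.

Definition beta_hat (N : nat) (k : R) (w : Omega) : R :=
  if 0 < p_hat N (k + 1) w then ln (p_hat N k w / p_hat N (k + 1) w) else 0.

Definition tail (PA : probability Omega R) (x : R) : R :=
  fine (PA [set w | (x%:E < tau 1 w)%E]).

End chains.

Section regular_variation.
Context (R : realType).

Definition slowly_varying (L : R -> R) : Prop :=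
  forall lambda : R, 0 < lambda -> L (lambda * z) / L z @[z --> +oo] --> (1 : R).

Definition tail_factor (beta : R) (Fbar : R -> R) (x : R) : R :=
  x `^ beta * Fbar x.

(* For an atomic chain, Fbar being the tail of the return time to the atom. *)
Definition beta_regular (beta : R) (Fbar : R -> R) : Prop :=
  slowly_varying (tail_factor beta Fbar).

End regular_variation.

Section mittag_leffler.
Context (R : realType).

(* Euler's integral, only meant for 0 < s. *)
Definition Gamma (s : R) : R :=
  \int[lebesgue_measure]_(t in `]0, +oo[) (t `^ (s - 1) * expR (- t)).

(* The moments determine the law. *)
Definition mittag_leffler d (T : measurableType d) (Q : probability T R)
    (beta : R) (M : {RV Q >-> R}) : Prop :=
  forall m : nat,
    'E_Q[(fun w => M w ^+ m)%R]%E = (m`!%:R / Gamma (1 + m%:R * beta))%:E.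

End mittag_leffler.

(* Main.v *)
Require Import Defs.
From HB Require Import structures.
From mathcomp Require Import all_boot all_order all_algebra.
From mathcomp Require Import all_classical all_reals all_analysis.
From mathcomp Require Import measurable_realfun ring lra zify.

Set Implicit Arguments.
Unset Strict Implicit.
Unset Printing Implicit Defensive.

Import Order.TTheory GRing.Theory Num.Theory.
Import numFieldNormedType.Exports.

Local Open Scope classical_set_scope.
Local Open Scope ring_scope.

(** The estimator is the logarithm of a ratio of two empirical frequencies of
long return times, so the point is to bound their distance to [p k] and
[p (k + 1)], uniformly over the values that the random number [N] of observed
durations takes in the window [[R / Fbar n, H / Fbar n]]; outside an event of
probability at most [delta] the hypothesis puts [N] in that window.

The chain restarts from one and the same law at each visit to the atom, and
Harris recurrence makes every [tau j] almost surely finite, whatever the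
initial law. Hence the indicators of [S_i > x] are independent Bernoulli trials
of parameter [Fbar x] ([exceedances_bernoulli_trials], [atom_tail]). For such
trials with partial sums [S_m] and parameter [p],
[exp (lambda (S_m - m p) - 2 m p lambda^2)] is a nonnegative supermartingale as
soon as [lambda <= 1 / 2], and Ville's maximal inequality controls all [m] at
once at the exponential cost of a single one ([bernoulli_deviation]). This
uniformity is what makes the dependence between [N] and the durations harmless.

Put [a = ln (36 / delta)], so that [v = a Fbar n / H], and take
[lambda_l = sqrt (v / p_l)]. The window gives [m p_l lambda_l^2 <= a], so that,
outside an event of probability at most [2 exp (- a) = delta / 18],
[|S_m - m p_l| < 3 a / lambda_l] for all [m] in the window. Dividing by [m p_l],
with [m >= R / Fbar n], the relative error of the frequency is at most
[3 y_l], where [y_l = lambda_l H / R]. The lower bound on [p (k + 1)] says that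
[y_(k+1) <= 1 / 40], which keeps the frequencies positive and makes their
logarithms accurate up to [6 y_l] ([log_frequency_error]). The two levels
contribute at most [12 y_(k+1)], and the difference between [beta] and
[ln (p k / p (k + 1))] is exactly the logarithm of the ratio of the slowly
varying factors ([ln_tail_factor_ratio]). The exceptional events add up to
[delta + delta / 9 < 2 delta]. *)

(** * Exponentials and logarithms *)

(** Invert [1 - x <= exp (- x)]; the geometric series accounts for the factor 2
as long as [x <= 1 / 2]. *)
Lemma expR_le_quadratic (R : realType) (x : R) :
  x <= 1 / 2 -> expR x <= 1 + x + 2 * x ^+ 2.
Proof.
move=> x12; have x1 : 0 < 1 - x by lra.
have : (1 - x) * expR x <= 1.
  rewrite -ler_pdivlMr ?expR_gt0// mul1r -expRN.
  by rewrite (le_trans _ (expR_ge1Dx _))// addrC.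
rewrite -ler_pdivlMl// mulr1 => /le_trans; apply.
rewrite -[leLHS]mulr1 ler_pdivrMl//.
have := sqr_ge0 x; nra.
Qed.

Lemma ln1D_norm_le (R : realType) (u : R) :
  `|u| <= 1 / 2 -> `|ln (1 + u)| <= 2 * `|u|.
Proof.
move=> u12; have /andP[ul uu] : - (1 / 2) <= u <= 1 / 2 by rewrite -ler_norml.
have u1 : 0 < 1 + u by lra.
have := ler_norm u; have := ler_norm (- u); rewrite normrN => uN uP.
have u0 := normr_ge0 u.
rewrite ler_norml; apply/andP; split; last first.
  by apply: le_trans (le_ln1Dx _) _; lra.
have <- : - ln (1 + u)^-1 = ln (1 + u) by rewrite lnV ?opprK ?posrE.
rewrite lerN2; have -> : (1 + u)^-1 = 1 + - (u / (1 + u)) by field; lra.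
have bnd : - (u / (1 + u)) <= 2 * `|u|.
  by rewrite -mulNr ler_pdivrMr//; nra.
apply: le_trans (le_ln1Dx _) bnd.
by rewrite ltrN2 ltr_pdivrMr//; lra.
Qed.

(** * Maximal inequalities for Bernoulli trials *)

Section bernoulli_trials.
Context d (Omega : measurableType d) (R : realType) (Pr : probability Omega R).
Implicit Types (xi : nat -> Omega -> bool) (s : seq bool) (p : R).

Definition outcomes xi (s : seq bool) : set Omega :=
  [set w | mkseq (xi ^~ w) (size s) = s].

(** Independence is required in its sequential form, each trial being
independent of the outcomes of the previous ones: this is what the strong Markov
property produces and what a supermartingale argument consumes. *)
Definition bernoulli_trials xi p : Prop :=
  forall s, measurable (outcomes xi s) /\
    Pr (outcomes xi (rcons s true)) = (p%:E * Pr (outcomes xi s))%E.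

Lemma outcomes_rcons xi s b :
  outcomes xi (rcons s b) = outcomes xi s `&` [set w | xi (size s) w = b].
Proof.
apply/seteqP; split => w; rewrite /outcomes /= size_rcons mkseqS.
  by move/rcons_inj => [-> ->].
by move=> [-> ->].
Qed.

Lemma outcomes_split xi s : outcomes xi s =
  outcomes xi (rcons s true) `|` outcomes xi (rcons s false).
Proof.
rewrite !outcomes_rcons -setIUr; apply/seteqP; split => w /= => [hs|[]//].
by split=> //; case: (xi _ w); [left|right].
Qed.

Lemma outcomes_rcons_false xi p s : bernoulli_trials xi p ->
  Pr (outcomes xi (rcons s false)) = ((1 - p)%:E * Pr (outcomes xi s))%E.
Proof.
move=> xip; have [ms prs] := xip s.
have [mt _] := xip (rcons s true); have [mf _] := xip (rcons s false).
have : Pr (outcomes xi s) = (Pr (outcomes xi (rcons s true)) +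
    Pr (outcomes xi (rcons s false)))%E.
  rewrite {1}outcomes_split measureU//.
  rewrite !outcomes_rcons; apply/seteqP; split => // w /= [[_ ->]] [_].
  by [].
rewrite prs.
rewrite -(@fineK _ (Pr (outcomes xi s))) ?fin_num_measure//.
rewrite -(@fineK _ (Pr (outcomes xi (rcons s false)))) ?fin_num_measure//.
rewrite -!EFinM -!EFinD => -[e]; congr EFin; rewrite [in RHS]mulrBl mul1r.
by rewrite {1}e addrAC subrr add0r.
Qed.

(** Ville's maximal inequality for the likelihood-like process
[\prod_(i < m) f (xi i)], a supermartingale when [f] has mean at most 1. The
process is followed from an arbitrary initial segment [s] of outcomes, so that
the bound can be proved by induction on the number [h] of remaining trials: if
the level [c] is not reached already, condition on the next trial. *)
Lemma ville_after_outcomes xi p (f : bool -> R) (c : R) (h : nat) s :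
  bernoulli_trials xi p -> 0 <= p <= 1 -> (forall b, 0 <= f b) ->
  p * f true + (1 - p) * f false <= 1 -> 0 < c ->
  let C := [set w | outcomes xi s w /\ exists2 m, (m <= h)%N &
    c <= \prod_(b <- mkseq (xi ^~ w) (size s + m)) f b] in
  measurable C /\
  (Pr C <= ((\prod_(b <- s) f b) / c)%:E * Pr (outcomes xi s))%E.
Proof.
move=> xip p01 f0 pf c0; elim: h s => [|h IH] s.
all: have [ms prs] := xip s.
all: have W0 t : 0 <= \prod_(b <- t) f b by apply: prodr_ge0.
all: have [cW|Wc] := leP c (\prod_(b <- s) f b).
all: have r0 : (0 <= Pr (outcomes xi s))%E by [].
- rewrite (_ : mkset _ = outcomes xi s); last first.
    apply/seteqP; split => w /= => [[]//|ws]; split=> //; exists 0%N => //.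
    by rewrite addn0 ws.
  by split=> //; rewrite lee_pemull// lee_fin ler_pdivlMr// mul1r.
- rewrite (_ : mkset _ = set0); last first.
    apply/seteqP; split => w //= [ws [m]]; rewrite leqn0 => /eqP ->.
    by rewrite addn0 ws leNgt Wc.
  by split=> //; rewrite measure0 mule_ge0// lee_fin divr_ge0// ltW.
- rewrite (_ : mkset _ = outcomes xi s); last first.
    apply/seteqP; split => w /= => [[]//|ws]; split=> //; exists 0%N => //.
    by rewrite addn0 ws.
  by split=> //; rewrite lee_pemull// lee_fin ler_pdivlMr// mul1r.
have [m1 P1] := IH (rcons s true); have [m0 P0] := IH (rcons s false).
set C1 := mkset _ in m1 P1; set C0 := mkset _ in m0 P0.
set C := mkset _.
have -> : C = C1 `|` C0.
  apply/seteqP; split => w /=; last first.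
    move=> [] [ws [m mh cm]].
      split; first by rewrite outcomes_split; left.
      by exists m.+1 => //; move: cm; rewrite size_rcons addSnnS.
    split; first by rewrite outcomes_split; right.
    by exists m.+1 => //; move: cm; rewrite size_rcons addSnnS.
  move=> [ws [[|m] mh cm]].
    by move: cm; rewrite addn0 ws leNgt Wc.
  move: (ws); rewrite {1}outcomes_split => -[] ws'; [left|right]; split=> //.
    by exists m => //; rewrite size_rcons addSnnS.
  by exists m => //; rewrite size_rcons addSnnS.
split; first exact: measurableU.
apply: le_trans (measureU2 _ m1 m0) _.
apply: le_trans (leeD P1 P0) _.
rewrite prs (outcomes_rcons_false s xip) -!cats1 !big_cat /= !big_seq1.
rewrite -(@fineK _ (Pr (outcomes xi s))) ?fin_num_measure//.
have : 0 <= fine (Pr (outcomes xi s)) by rewrite fine_ge0.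
move: (fine _) => r rge0.
rewrite -!EFinM -EFinD lee_fin.
set W := \prod_(_ <- _) _.
have -> : W * f true / c * (p * r) + W * f false / c * ((1 - p) * r) =
  (W / c * r) * (p * f true + (1 - p) * f false).
  by ring.
rewrite ler_piMr// mulr_ge0// divr_ge0//; last exact: ltW.
exact: W0.
Qed.

(** The process [exp (lambda (S_m - m p) - 2 m p lambda^2)] satisfies the
hypothesis of Ville's inequality because the moment generating function of a
trial is at most [exp (p (exp lambda - 1))], where [exp lambda - 1] is at most
[lambda + 2 lambda^2]. *)
Lemma ville_exp xi p (lambda c : R) (h : nat) :
  bernoulli_trials xi p -> 0 <= p <= 1 -> `|lambda| <= 1 / 2 ->
  exists2 B : set Omega, measurable B /\ (Pr B <= (expR (- c))%:E)%E &
    forall w, ~ B w -> forall m, (m <= h)%N ->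
    lambda * (\sum_(0 <= i < m) (xi i w)%:R - m%:R * p) <
      c + 2 * m%:R * p * lambda ^+ 2.
Proof.
move=> xip p01 l12; have /andP[p0 p1] := p01.
have ll : lambda <= 1 / 2 by rewrite (le_trans (ler_norm _)).
pose f (b : bool) := expR (lambda * (b%:R - p) - 2 * p * lambda ^+ 2).
have f1 : p * f true + (1 - p) * f false <= 1.
  have fE b : f b = expR (b%:R * lambda) *
      expR (- (p * (lambda + 2 * lambda ^+ 2))).
    by rewrite -expRD /f; congr expR; ring.
  rewrite !fE mul1r mul0r expR0 !mulrA -mulrDl expRN ler_pdivrMr ?expR_gt0//.
  rewrite mul1r mulr1; apply: le_trans (expR_ge1Dx _).
  have := expR_le_quadratic ll; nra.
have [mC PC] := ville_after_outcomes h [::] xip p01 (fun b => expR_ge0 _) f1 (expR_gt0 c).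
set C := mkset _ in mC PC; exists C.
  split=> //; apply: le_trans PC _.
  rewrite big_nil div1r -expRN -[leRHS]mule1 lee_wpmul2l// ?lee_fin ?expR_ge0//.
  by apply: probability_le1; have [] := xip [::].
move=> w wC m mh; rewrite ltNge; apply/negP => cm; apply: wC; split=> //.
exists m => //; rewrite add0n /mkseq big_map.
rewrite /f -(big_morph _ (@expRD R) (@expR0 R)) ler_expR.
have -> : iota 0 m = index_iota 0 m by rewrite /index_iota subn0.
rewrite sumrB -big_distrr/= sumrB !sumr_const_nat subn0.
rewrite -[p *+ m]mulr_natl -[(_ * _) *+ m]mulr_natl lerBrDr; apply: le_trans cm.
by rewrite lerD2l le_eqVlt; apply/orP; left; apply/eqP; ring.
Qed.

(** A Chernoff bound uniform in the number [m <= h] of trials: apply [ville_exp]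
at level [exp a] with [lambda] and [- lambda]; the drift [2 m p lambda^2] costs
at most another [2 a]. The bad event is delivered as a measurable superset. *)
Lemma bernoulli_deviation xi p (lambda a : R) (h : nat) :
  bernoulli_trials xi p -> 0 <= p <= 1 -> 0 < lambda <= 1 / 2 ->
  h%:R * p * lambda ^+ 2 <= a ->
  exists2 B : set Omega, measurable B /\ (Pr B <= (2 * expR (- a))%:E)%E &
    forall w, ~ B w -> forall m, (m <= h)%N ->
    `|\sum_(0 <= i < m) (xi i w)%:R - m%:R * p| < 3 * a / lambda.
Proof.
move=> xip p01 /andP[l0 l12] ha; have /andP[p0 p1] := p01.
have lN : `|lambda| <= 1 / 2 by rewrite gtr0_norm.
have lN' : `|- lambda| <= 1 / 2 by rewrite normrN.
have [B1 [mB1 PB1] hB1] := @ville_exp xi p lambda a h xip p01 lN.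
have [B2 [mB2 PB2] hB2] := @ville_exp xi p (- lambda) a h xip p01 lN'.
exists (B1 `|` B2).
  split; first exact: measurableU.
  apply: le_trans (measureU2 _ mB1 mB2) _.
  by rewrite mulr_natl mulr2n EFinD leeD.
move=> w /not_orP[/hB1 w1 /hB2 w2] m mh.
have mp : m%:R * p * lambda ^+ 2 <= a.
  by apply: le_trans ha; rewrite !ler_wpM2r ?ler_nat ?sqr_ge0.
have := w1 m mh; have := w2 m mh; rewrite sqrrN => h2 h1.
rewrite ltr_pdivlMr// -[X in _ * X]gtr0_norm// -normrM ltr_norml.
by apply/andP; split; nra.
Qed.

End bernoulli_trials.

(** * Disintegration along a transition kernel *)

Section disintegration.
Context d (E : measurableType d) d' (Omega : measurableType d') (R : realType).
Variables (mu : {measure set Omega -> \bar R}) (F : set Omega).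
Variables (Y : Omega -> E) (l : Omega -> {measure set E -> \bar R}).
Hypotheses (mF : measurable F) (mY : measurable_fun setT Y).
Hypothesis ml : forall B, measurable B -> measurable_fun setT (fun w => l w B : \bar R).
Hypothesis law_Y : forall B, measurable B ->
  mu (F `&` Y @^-1` B) = (\int[mu]_(w in F) l w B)%E.

Import HBNNSimple.
Local Open Scope ereal_scope.

Let disintegration_nnsfun (g : {nnsfun E >-> R}) :
  \int[mu]_(w in F) (g (Y w))%:E = \int[mu]_(w in F) \int[l w]_y (g y)%:E.
Proof.
have mgr r : measurable (g @^-1` [set r]) by [].
have mYg r : measurable (Y @^-1` (g @^-1` [set r])).
  by rewrite -[X in measurable X]setTI; exact: mY.
transitivity (\sum_(r \in range g) \int[mu]_(w in F)
    (r * \1_(Y @^-1` (g @^-1` [set r])) w)%:E).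
  rewrite -ge0_integral_fsum//; last 2 first.
  - by move=> r; apply/measurable_EFinP/measurable_funM.
  - move=> r w Fw; rewrite EFinM.
    have := nnfun_muleindic_ge0 g r (Y w).
    by rewrite !indicE.
  by apply: eq_integral => w _; rewrite fsumEFin// fimfunE.
under [in RHS]eq_integral.
  move=> w _.
  under eq_integral.
    by move=> z _; rewrite fimfunE -fsumEFin//; over.
  rewrite /= ge0_integral_fsum//; last 2 first.
    - by move=> r; exact/measurable_EFinP/measurableT_comp.
    - by move=> r z _; rewrite EFinM nnfun_muleindic_ge0.
  under eq_fsbigr.
    move=> r _.
    rewrite (integralZl_indic _ (fun r => g @^-1` [set r]))//; last first.
      by move=> r0; rewrite preimage_nnfun0.
    rewrite integral_indic// setIT.
    over.
  over.
rewrite /= ge0_integral_fsum//; last 2 first.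
- by move=> r; apply/measurable_funTS/measurable_funeM/ml.
- move=> r w _.
  have := mulemu_ge0 (fun n => g @^-1` [set n]).
  by apply; exact: preimage_nnfun0.
apply: eq_fsbigr => r _.
rewrite (integralZl_indic _ (fun r => Y @^-1` (g @^-1` [set r])))//; last first.
  by move=> r0; rewrite preimage_nnfun0// preimage_set0.
rewrite integral_indic// setIC law_Y//.
have [r0|r0] := leP 0%R r.
  by rewrite ge0_integralZl//; exact/measurable_funTS/ml.
by rewrite !integral0_eq ?mule0// => w _; rewrite preimage_nnfun0// measure0 ?mule0.
Qed.

(** The Markov property is given for events; this extends it to nonnegative
functions of the next state. *)
Lemma ge0_integral_disintegration (g : E -> \bar R) :
  (forall y, 0 <= g y) -> measurable_fun setT g ->
  \int[mu]_(w in F) g (Y w) = \int[mu]_(w in F) \int[l w]_y g y.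
Proof.
move=> g0 mg; pose h := nnsfun_approx measurableT mg.
have mh n : measurable_fun setT (EFin \o h n) by exact/measurable_EFinP.
have ndh y : {homo (fun n => (h n y)%:E) : a b / (a <= b)%N >-> a <= b}.
  by move=> a b ab; rewrite lee_fin; exact/lefP/nd_nnsfun_approx.
transitivity (limn (fun n => \int[mu]_(w in F) (h n (Y w))%:E)).
  rewrite -monotone_convergence//; last 2 first.
  - by move=> n; apply: measurable_funTS; exact: measurableT_comp (mh n) mY.
  - by move=> n w _; rewrite lee_fin.
  apply: eq_integral => w _; apply/esym/cvg_lim => //.
  exact: cvg_nnsfun_approx.
under [X in limn X]eq_fun do rewrite disintegration_nnsfun.
rewrite -monotone_convergence//; last 3 first.
- move=> n; apply: measurable_funTS.
  apply: measurable_fun_integral_kernel => //; last exact: mh.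
  by move=> y; rewrite lee_fin.
- by move=> n w _; apply: integral_ge0 => y _; rewrite lee_fin.
- move=> w _ a b ab; apply: ge0_le_integral => //.
  + by move=> y _; rewrite lee_fin.
  + exact: mh.
  + exact: mh.
  + by move=> y _; exact: ndh.
apply: eq_integral => w _.
rewrite -monotone_convergence//; last first.
  by move=> n y _; rewrite lee_fin.
by apply: eq_integral => y _; apply/cvg_lim => //; exact: cvg_nnsfun_approx.
Qed.

End disintegration.

(** * Visits to a set along a trajectory *)

Section return_times.
Context d (E : measurableType d) d' (Omega : measurableType d') (R : realType).
Variables (X : nat -> {mfun Omega >-> E}) (A : set E).

Notation tau := (tau R X A).
Notation duration := (duration R X A).

Definition avoids (s m : nat) : set Omega :=
  [set w | forall r, (s < r <= s + m)%N -> ~ A (X r w)].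

Lemma ereal_inf_natE (S : set nat) (t : nat) :
  ereal_inf [set n%:R%:E | n in S] = t%:R%:E :> \bar R <->
  S t /\ forall r, S r -> (t <= r)%N.
Proof.
split=> [infS|[St tmin]]; last first.
  apply/eqP; rewrite eq_le; apply/andP; split.
    by apply: ereal_inf_lbound; exists t.
  by apply/ereal_infP => _ [r Sr <-]; rewrite lee_fin ler_nat; exact: tmin.
have tmin r : S r -> (t <= r)%N.
  move=> Sr; rewrite -(ler_nat R) -lee_fin -infS.
  by apply: ereal_inf_lbound; exists r.
split=> //; have : (ereal_inf [set n%:R%:E | n in S] < t.+1%:R%:E :> \bar R)%E.
  by rewrite infS lte_fin ltr_nat.
move=> /ereal_inf_lt[_ [r Sr <-]]; rewrite lte_fin ltr_nat ltnS => rt.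
by have /eqP <- : r == t by rewrite eqn_leq rt tmin.
Qed.

Lemma ereal_inf_nat_attained (S : set nat) (r : nat) : S r ->
  exists t, ereal_inf [set n%:R%:E | n in S] = t%:R%:E :> \bar R.
Proof.
move=> Sr; have exS : exists n, `[< S n >] by exists r; exact/asboolP.
exists (ex_minn exS); apply/ereal_inf_natE.
case: ex_minnP => t /asboolP St tmin; split=> // q Sq; apply: tmin.
exact/asboolP.
Qed.

Lemma tau_case j w : (exists t : nat, tau j w = t%:R%:E) \/ tau j w = +oo%E.
Proof.
case: j => [|j]; first by left; exists 0%N.
have [[r Sr]|noS] := pselect (exists r : nat, (tau j w < r%:R%:E)%E /\ A (X r w)).
  by left; apply: ereal_inf_nat_attained; exact: Sr.
right; rewrite /= (_ : mkset _ = set0) ?image_set0 ?ereal_inf0//.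
by apply/seteqP; split => // r Sr; apply: noS; exists r.
Qed.

Lemma tauSE j w t : tau j.+1 w = t%:R%:E <->
  A (X t w) /\ exists2 s, (s < t)%N & tau j w = s%:R%:E /\ avoids s (t - s.+1) w.
Proof.
rewrite [tau _ _]/= ereal_inf_natE /=; split.
  move=> [[st At] tmin]; split=> //.
  have [[s sE]|oo] := tau_case j w; last by move: st; rewrite oo.
  rewrite sE lte_fin ltr_nat in st; exists s => //; split=> // r /andP[sr rt] Ar.
  have := tmin r; rewrite sE lte_fin ltr_nat => /(_ (conj sr Ar)).
  by lia.
move=> [At [s st [sE av]]]; split; first by rewrite sE lte_fin ltr_nat.
move=> r []; rewrite sE lte_fin ltr_nat => sr Ar; rewrite leqNgt; apply/negP => rt.
by apply: (av r) => //; rewrite sr/=; lia.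
Qed.

Lemma tauS_finite j s r w :
  tau j w = s%:R%:E -> (s < r)%N -> A (X r w) ->
  exists t : nat, tau j.+1 w = t%:R%:E.
Proof.
move=> sE sr Ar; have st : (tau j w < r%:R%:E)%E by rewrite sE lte_fin ltr_nat.
exact: (@ereal_inf_nat_attained [set n | (tau j w < n%:R%:E)%E /\ A (X n w)] r).
Qed.

Lemma tauS_pinfty j w : tau j w = +oo%E -> tau j.+1 w = +oo%E.
Proof.
move=> joo; rewrite [LHS]/= joo (_ : mkset _ = set0) ?image_set0 ?ereal_inf0//.
by apply/seteqP; split => // r /= [].
Qed.

(** Seen from the visit at time [s], a long duration is an event about the
next [trunc x] steps only, with no reference to the next visit. *)
Lemma duration_gtE j s (x : R) w : 0 <= x -> tau j w = s%:R%:E ->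
  (x%:E < duration j w)%E <-> avoids s (Num.truncn x) w.
Proof.
move=> x0 sE; rewrite /duration sE.
have [[t tE]|oo] := tau_case j.+1 w; last first.
  rewrite oo /= addye// ltry; split=> // _ r /andP[sr _] Ar.
  by have [t] := tauS_finite sE sr Ar; rewrite oo.
have [At [s' st [s'E av]]] := (tauSE j w t).1 tE.
have ss : s' = s.
  by apply/eqP; rewrite -(eqr_nat R) -eqe -sE -s'E.
subst s'; rewrite tE -EFinB lte_fin -natrB 1?ltnW//.
rewrite -truncn_lt_nat//; split=> [xt r /andP[sr rx]|avx].
  by apply: av; rewrite sr /=; lia.
rewrite ltnNge; apply/negP => tx.
by apply: (avx t) => //; rewrite st/=; lia.
Qed.

(** If the visit number [j] never occurs, the duration is [+oo - +oo = -oo]. *)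
Lemma duration_pinfty j w (x : R) : tau j w = +oo%E ->
  (x%:E < duration j w)%E = false.
Proof. by move=> oo; rewrite /duration oo (tauS_pinfty oo) /=; exact/negbTE. Qed.

End return_times.

(** * Events determined by the past *)

Section past.
Context d (E : measurableType d) d' (Omega : measurableType d').
Variables (X : nat -> {mfun Omega >-> E}) (A : set E).
Hypothesis mA : measurable A.

Lemma past_coord i n B : (i <= n)%N -> measurable B -> past X n (X i @^-1` B).
Proof. by move=> ni mB; apply: sub_sigma_algebra; exists i, B. Qed.

Lemma measurable_coord i B : measurable B -> measurable (X i @^-1` B).
Proof.
move=> mB; rewrite -[X in measurable X]setTI.
exact: measurable_funPT.
Qed.

Lemma past_measurable n F : past X n F -> measurable F.
Proof.
apply: smallest_sub; first exact: sigma_algebra_measurable.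
by move=> _ [i [B [_ mB ->]]]; exact: measurable_coord.
Qed.

Lemma past_leq m n : (m <= n)%N -> past X m `<=` past X n.
Proof.
move=> mn; apply: sub_sigma_algebra2 => _ [i [B [im mB ->]]].
by exists i, B; split=> //; exact: leq_trans im mn.
Qed.

Lemma past0 n : past X n set0.
Proof. exact: sigma_algebra0. Qed.

Lemma pastC n F : past X n F -> past X n (~` F).
Proof. exact: sigma_algebraC. Qed.

Lemma past_bigcup n (F : nat -> set Omega) :
  (forall i, past X n (F i)) -> past X n (\bigcup_i F i).
Proof. exact: sigma_algebra_bigcup. Qed.

Lemma pastI n F G : past X n F -> past X n G -> past X n (F `&` G).
Proof.
move=> pF pG; rewrite -[F `&` G]setCK setCI -bigcup2E; apply: pastC.
apply: past_bigcup => -[|[|i]] /=; [exact: pastC|exact: pastC|exact: past0].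
Qed.

Lemma past_avoids s m n : (s + m <= n)%N -> past X n (avoids X A s m).
Proof.
move=> smn.
rewrite (_ : avoids _ _ _ _ =
  ~` \bigcup_r (if (s < r <= s + m)%N then X r @^-1` A else set0)).
  apply: pastC; apply: past_bigcup => r; case: ifPn => [/andP[_ rm]|_]; last exact: past0.
  exact: (past_coord (leq_trans rm smn) mA).
apply/seteqP; split => w.
  by move=> av [r _]; case: ifPn => // rm Ar; exact: (av r).
by move=> nw r rm Ar; apply: nw; exists r => //; rewrite rm.
Qed.

Lemma measurable_avoids s m : measurable (avoids X A s m).
Proof. exact: past_measurable (past_avoids (leqnn _)). Qed.

Lemma avoids0 s : avoids X A s 0 = setT.
Proof.
by apply/seteqP; split => // w _ r; rewrite addn0 ltnNge => /andP[/negP].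
Qed.

Lemma avoidsS s m : avoids X A s m.+1 = ~` (X s.+1 @^-1` A) `&` avoids X A s.+1 m.
Proof.
apply/seteqP; split => w.
  move=> av; split => [As|r rm]; first by apply: (av s.+1) => //; lia.
  by apply: av; lia.
move=> [nA av] r rm; have [->//|rs] := eqVneq r s.+1.
by apply: av; lia.
Qed.

Variable R : realType.

Lemma past_tau j t : past X t [set w | tau R X A j w = t%:R%:E].
Proof.
elim: j t => [|j IH] t.
  have [->|t0] := eqVneq t 0%N.
    rewrite (_ : mkset _ = ~` set0); last by rewrite setC0; apply/seteqP; split.
    apply: pastC; exact: past0.
  rewrite (_ : mkset _ = set0); first exact: past0.
  apply/seteqP; split => // w /= /eqP.
  by rewrite eqe eq_sym (eqr_nat R t 0) (negbTE t0).
rewrite (_ : mkset _ = X t @^-1` A `&` \bigcup_s (if (s < t)%N then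
    [set w | tau R X A j w = s%:R%:E] `&` avoids X A s (t - s.+1) else set0)).
  apply: pastI; first exact: (past_coord (leqnn t) mA).
  apply: past_bigcup => s; case: ifPn => st; last exact: past0.
  apply: pastI; last by apply: past_avoids; lia.
  by apply: past_leq (IH s); exact: ltnW.
apply/seteqP; split => w.
  by move=> /tauSE[At [s st [sE av]]]; split=> //; exists s => //; rewrite st.
move=> [At [s _]]; case: ifPn => // st [sE av].
by apply/tauSE; split=> //; exists s.
Qed.

Lemma measurable_tau j t : measurable [set w | tau R X A j w = t%:R%:E].
Proof. exact: (past_measurable (@past_tau j t)). Qed.

(** Trials are numbered from 0 and durations from 1. *)
Definition exceedances (x : R) (i : nat) (w : Omega) : bool :=
  (x%:E < duration R X A i.+1 w)%E.

Lemma exceedancesE x i : 0 <= x ->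
  [set w | exceedances x i w] =
  \bigcup_r ([set w | tau R X A i.+1 w = r%:R%:E] `&` avoids X A r (Num.truncn x)).
Proof.
move=> x0; apply/seteqP; split => w.
  move=> xi; have [[r rE]|oo] := tau_case R X A i.+1 w.
    by exists r => //; split=> //; exact: (duration_gtE x0 rE).1.
  by move: xi; rewrite /exceedances /= duration_pinfty.
by move=> [r _ [rE av]]; exact: (duration_gtE x0 rE).2.
Qed.

Lemma measurable_exceedances x i b : 0 <= x ->
  measurable [set w | exceedances x i w = b].
Proof.
move=> x0; have mt : measurable [set w | exceedances x i w].
  rewrite exceedancesE//; apply: bigcupT_measurable => r; apply: measurableI.
    exact: measurable_tau.
  exact: measurable_avoids.
case: b => //; rewrite (_ : mkset _ = ~` [set w | exceedances x i w]).
  exact: measurableC.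
by apply/seteqP; split => w /=; case: exceedances.
Qed.

Lemma measurable_outcomes x s : 0 <= x -> measurable (outcomes (exceedances x) s).
Proof.
move=> x0; elim/last_ind: s => [|s b IH].
  by rewrite (_ : outcomes _ _ = setT)//; apply/seteqP; split.
rewrite outcomes_rcons; apply: measurableI => //.
exact: measurable_exceedances.
Qed.

(** At the visit number [size s].+1 the first [size s] durations have been
completed, hence are known. *)
Lemma past_outcomes x s t : 0 <= x ->
  past X t (outcomes (exceedances x) s `&`
            [set w | tau R X A (size s).+1 w = t%:R%:E]).
Proof.
move=> x0; elim/last_ind: s t => [|s b IH] t.
  rewrite (_ : outcomes _ _ = setT) ?setTI; first exact: past_tau.
  by apply/seteqP; split.
rewrite size_rcons (_ : _ `&` _ = \bigcup_r (
  if (r < t)%N && ((Num.truncn x < t - r)%N == b) then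
    (outcomes (exceedances x) s `&` [set w | tau R X A (size s).+1 w = r%:R%:E])
    `&` [set w | tau R X A (size s).+2 w = t%:R%:E] else set0)).
  apply: past_bigcup => r; case: ifPn => [/andP[rt _]|_]; last exact: past0.
  apply: pastI; last exact: past_tau.
  by apply: past_leq (IH r); exact: ltnW.
have xE r w : (r < t)%N -> tau R X A (size s).+1 w = r%:R%:E ->
    tau R X A (size s).+2 w = t%:R%:E ->
    exceedances x (size s) w = (Num.truncn x < t - r)%N.
  move=> rt rE tE; rewrite /exceedances /duration rE tE -EFinB lte_fin.
  by rewrite truncn_lt_nat// natrB 1?ltnW.
rewrite outcomes_rcons; apply/seteqP; split => w.
  move=> [[os eb] tE]; have [At [r rt [rE av]]] := (tauSE R X A _ w t).1 tE.
  by exists r => //; rewrite rt -(xE r w)// eb eqxx.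
move=> [r _]; case: ifPn => // /andP[rt /eqP <-] [[os rE] tE].
by split=> //; split=> //=; exact: xE.
Qed.

End past.

(** * The chain regenerates at the atom *)

Section markov.
Context d (E : measurableType d) d' (Omega : measurableType d') (R : realType).
Variables (Pi : R.-pker E ~> E) (X : nat -> {mfun Omega >-> E}) (A : set E).
Hypothesis mA : measurable A.
Local Open Scope ereal_scope.

(** The probability to avoid [A] during [m] steps from [x], defined through the
kernel so that it is measurable in [x]: this is what links the laws of the chain
for different initial distributions. *)
Fixpoint escape (m : nat) (x : E) : \bar R :=
  if m is n.+1 then \int[Pi x]_y (escape n \_ (~` A)) y else 1.

Lemma escape_ge0 m x : 0 <= escape m x.
Proof.
elim: m x => [|m IH] x //=; apply: integral_ge0 => y _.
by rewrite erestrict_ge0.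
Qed.

Lemma measurable_escape m : measurable_fun setT (escape m).
Proof.
elim: m => [|m IH] /=; first exact: measurable_cst.
apply: measurable_fun_integral_kernel.
- by move=> U mU; exact: measurable_kernel.
- by move=> y; rewrite erestrict_ge0// => z _; exact: escape_ge0.
- by apply/(measurable_restrictT _ (measurableC mA)); exact: measurable_funTS.
Qed.

Lemma escape_le1 m x : escape m x <= 1.
Proof.
elim: m x => [|m IH] x //=.
apply: (@le_trans _ _ (\int[Pi x]_y cst 1 y)).
  apply: ge0_le_integral => //.
  - by move=> y _; rewrite erestrict_ge0// => z _; exact: escape_ge0.
  - apply/(measurable_restrictT _ (measurableC mA)).
    exact: measurable_funTS (measurable_escape m).
  - by move=> y _; rewrite patchE; case: ifP.
by rewrite integral_cst// mul1e prob_kernel.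
Qed.

Lemma escape_atom a x m : (forall B, measurable B -> Pi x B = Pi a B) ->
  escape m x = escape m a.
Proof.
move=> xa; case: m => [|m] //=; apply: eq_measure_integral => B mB _.
exact: xa.
Qed.

Variables (Pr : probability Omega R) (mu : probability E R).
Hypothesis Xmarkov : markov_chain Pr X Pi mu.

(** Moving one step of avoidance into the past reduces [m.+1] to [m]; the kernel
then integrates out the state at time [j.+1]. *)
Lemma markov_avoids j m F : past X j F ->
  Pr (F `&` avoids X A j m) = \int[Pr]_(w in F) escape m (X j w).
Proof.
elim: m j F => [|m IH] j F pF.
  rewrite avoids0 setIT /= integral_cst ?mul1e//.
  exact: past_measurable pF.
have mF := past_measurable pF.
have pC : past X j.+1 (~` (X j.+1 @^-1` A)) by apply: pastC; exact: (past_coord (leqnn j.+1) mA).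
rewrite avoidsS setIA IH; last first.
  by apply: pastI => //; apply: past_leq pF.
rewrite integral_mkcondr.
transitivity (\int[Pr]_(w in F) (escape m \_ (~` A)) (X j.+1 w)).
  by apply: eq_integral => w _; rewrite !patchE; congr (if _ then _ else _).
rewrite (@ge0_integral_disintegration _ _ _ _ _ Pr F (X j.+1) (fun w => Pi (X j w)))//.
- move=> B mB; apply: (measurableT_comp (measurable_kernel Pi B mB)).
  exact: measurable_funPT.
- by move=> B mB; exact: Xmarkov.2.
- by move=> y; rewrite erestrict_ge0// => z _; exact: escape_ge0.
- apply/(measurable_restrictT _ (measurableC mA)).
  exact: measurable_funTS (measurable_escape m).
Qed.

(** All states of the atom have the same escape probability, so a past event on
which the chain sits in the atom is independent of the next steps. *)
Lemma atom_avoids j m F a :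
  (forall x, A x -> forall B, measurable B -> Pi x B = Pi a B) ->
  past X j F -> F `<=` X j @^-1` A ->
  Pr (F `&` avoids X A j m) = escape m a * Pr F.
Proof.
move=> atom pF FA; rewrite markov_avoids//.
rewrite (eq_integral (cst (escape m a))); last first.
  move=> w; rewrite inE => Fw; apply: escape_atom; apply: atom; exact: FA.
rewrite integral_cst//; last exact: past_measurable pF.
Qed.

(** Integrate the escape probability against the law of [X j] and use dominated
convergence: recurrence from every point gives recurrence from every law. *)
Lemma escape_cvg0_avoids_negligible j : (forall x, escape m x @[m --> \oo] --> 0) ->
  Pr (\bigcap_m avoids X A j m) = 0.
Proof.
move=> esc0.
have mav m : measurable (avoids X A j m).
  exact: measurable_avoids.
have cap : (Pr \o avoids X A j) m @[m --> \oo] --> Pr (\bigcap_m avoids X A j m).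
  apply: nonincreasing_cvg_mu => //.
  - by rewrite ltey_eq fin_num_measure.
  - exact: bigcapT_measurable.
  - move=> m n mn; apply/subsetPset => w av r rm; apply: av.
    by move: rm mn; clear; lia.
have int0 : \int[Pr]_w escape m (X j w) @[m --> \oo] --> 0.
  have [] := @dominated_convergence _ _ _ Pr setT measurableT
    (fun m w => escape m (X j w)) (cst 0) (cst 1).
  - move=> m; apply: (measurableT_comp (measurable_escape m)).
    exact: measurable_funPT.
  - exact: measurable_cst.
  - by apply: aeW => w _; exact: esc0.
  - exact: finite_measure_integrable_cst.
  - apply: aeW => w m _; rewrite gee0_abs ?escape_ge0//.
    exact: escape_le1.
  by move=> _ _; rewrite integral0.
apply: (cvg_unique _ cap) => //.
rewrite (_ : _ \o _ = fun m => \int[Pr]_w escape m (X j w))//.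
apply/funext => m /=; rewrite -markov_avoids ?setTI//.
by rewrite -setC0; apply: pastC; exact: past0.
Qed.

(** An infinite [tau j] means that time 0, or some visit, is not followed by any
visit. *)
Lemma tau_finite_ae j : (forall x, escape m x @[m --> \oo] --> 0) ->
  Pr (~` \bigcup_t [set w | tau R X A j w = t%:R%:E]) = 0.
Proof.
move=> esc0.
have mtau i t : measurable [set w | tau R X A i w = t%:R%:E].
  exact: measurable_tau.
have never_null : Pr (\bigcup_s \bigcap_m avoids X A s m) = 0.
  have mcap s : measurable (\bigcap_m avoids X A s m).
    by apply: bigcapT_measurable => m; exact: measurable_avoids.
  apply/negligibleP; first exact: bigcupT_measurable.
  apply: negligible_bigcup => s; apply/negligibleP => //.
  exact: escape_cvg0_avoids_negligible.
apply: (subset_measure0 _ _ _ never_null).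
- by apply: measurableC; exact: bigcupT_measurable.
- apply: bigcupT_measurable => s; apply: bigcapT_measurable => m.
  exact: measurable_avoids.
elim: j => [|j IH] w inf.
  by exfalso; apply: inf; exists 0%N.
have [[s sE]|oo] := tau_case R X A j w; last first.
  by apply: IH => -[t _ /=]; rewrite oo.
exists s => // m _ r /andP[sr _] Ar; apply: inf.
by have [t tE] := tauS_finite sE sr Ar; exists t.
Qed.

(** Split along the time [r] of the visit that starts the duration, which is
almost surely finite. On each piece the previous outcomes are a past event on
which the chain sits in the atom at time [r]. *)
Lemma exceedances_bernoulli_trials a (x : R) :
  (forall y, A y -> forall B, measurable B -> Pi y B = Pi a B) ->
  (forall y, escape m y @[m --> \oo] --> 0) -> (0 <= x)%R ->
  bernoulli_trials Pr (exceedances X A x) (fine (escape (Num.truncn x) a)).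
Proof.
move=> atom esc0 x0 s; split; first exact: measurable_outcomes.
set m := Num.truncn x; set O := outcomes _ s.
pose T r := [set w | tau R X A (size s).+1 w = r%:R%:E].
have mT r : measurable (T r) by exact: measurable_tau.
have mO : measurable O by exact: measurable_outcomes.
have mOT r : measurable (O `&` T r) by exact: measurableI.
have mav r : measurable (avoids X A r m).
  exact: measurable_avoids.
have tT : trivIset setT T.
  move=> r r' _ _ [w []]; rewrite /T /= => -> /eqP.
  by rewrite eqe eqr_nat => /eqP.
have finT (B : set Omega) : measurable B ->
    Pr B = \sum_(0 <= r <oo) Pr (B `&` T r).
  move=> mB; rewrite (_ : Pr B = Pr (\bigcup_r (B `&` T r))).
    rewrite measure_bigcup//; last by exact: trivIset_setIl.
      by apply: eq_eseriesl => r; rewrite in_setT.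
    by move=> r _; exact: measurableI.
  rewrite -setI_bigcupr.
  have mU : measurable (\bigcup_r T r) by exact: bigcupT_measurable.
  rewrite (measureDI Pr mB mU) [X in X + _](_ : _ = 0) ?add0e//.
  apply/eqP; rewrite -measure_le0 -(tau_finite_ae (size s).+1 esc0).
  by apply: le_measure; rewrite ?inE; [exact: measurableD|exact: measurableC|
    exact: subIsetr].
have escN : escape m a \is a fin_num.
  rewrite ge0_fin_numE ?escape_ge0//.
  by rewrite (le_lt_trans (escape_le1 _ _)) ?ltry.
rewrite outcomes_rcons fineK// exceedancesE// setI_bigcupr.
under eq_bigcupr do rewrite setIA.
rewrite measure_bigcup//; last 2 first.
- by move=> r _; exact: measurableI (mOT r) (mav r).
- apply: trivIset_setIr; apply: trivIset_setIl; exact: tT.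
rewrite (finT O mO) -(fineK escN) -nneseriesZl//.
rewrite fineK// (@eq_eseriesl _ _ xpredT); last by move=> r; rewrite in_setT.
apply: eq_eseriesr => r _.
apply: atom_avoids => //; first exact: past_outcomes.
by move=> w [_ /= /tauSE[]].
Qed.

Lemma tail_avoids (x : R) : (0 <= x)%R ->
  tail X A Pr x = fine (Pr (avoids X A 0 (Num.truncn x))).
Proof.
move=> x0; rewrite /tail; congr (fine (Pr _)); apply/seteqP; split => w.
  move=> xw; apply/(@duration_gtE _ _ _ _ R X A 0 0 x w x0 erefl).
  by rewrite /duration sube0.
move=> /(@duration_gtE _ _ _ _ R X A 0 0 x w x0 erefl).
by rewrite /duration sube0.
Qed.

(** The initial law sits on the atom, so intersecting with the event that the
chain starts there changes no probability and [atom_avoids] applies. *)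
Lemma atom_tail a (x : R) :
  (forall y, A y -> forall B, measurable B -> Pi y B = Pi a B) ->
  mu A = 1 -> (0 <= x)%R ->
  tail X A Pr x = fine (escape (Num.truncn x) a).
Proof.
move=> atom muA x0; rewrite tail_avoids//; congr fine.
have pA : past X 0 (X 0%N @^-1` A) := past_coord (leqnn 0) mA.
have mXA := past_measurable pA.
have mav := measurable_avoids X mA 0 (Num.truncn x).
have PA : Pr (X 0%N @^-1` A) = 1 by rewrite Xmarkov.1.
rewrite -[RHS]mule1 -PA -(atom_avoids _ atom pA)//.
rewrite setIC (measureDI Pr mav mXA) [X in X + _](_ : _ = 0) ?add0e//.
apply/eqP; rewrite -measure_le0.
rewrite (_ : 0 = Pr (~` (X 0%N @^-1` A))); last first.
  by rewrite probability_setC// PA subee.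
by apply: le_measure; rewrite ?inE; [exact: measurableD|exact: measurableC|
  exact: subIsetr].
Qed.

End markov.

(** Under Harris recurrence the event of never visiting [A] is null from each
starting point, and it is the decreasing limit of the avoidance events. *)
Lemma harris_escape_cvg0 d (E : measurableType d) d' (Omega : measurableType d')
  (R : realType) (Pi : R.-pker E ~> E) (psi : {measure set E -> \bar R})
  (X : nat -> {mfun Omega >-> E}) (P : probability E R -> probability Omega R)
  (A : set E) :
  (forall mu, markov_chain (P mu) X Pi mu) -> harris_recurrent X P psi ->
  measurable A -> (0 < psi A)%E ->
  forall x, (escape Pi A m x @[m --> \oo] --> 0)%E.
Proof.
move=> Xmarkov harris mA psiA x.
have mX n : measurable (X n @^-1` A) by exact: measurable_coord.
have mav m : measurable (avoids X A 0 m).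
  exact: measurable_avoids.
have io : P \d_x (lim_sup_set (fun n => X n @^-1` A)) = 1%E by exact: harris.
have mio : measurable (lim_sup_set (fun n => X n @^-1` A)).
  apply: bigcapT_measurable => n; apply: bigcup_measurable => k _; exact: mX.
have null : P \d_x (\bigcap_m avoids X A 0 m) = 0%E.
  apply/eqP; rewrite -measure_le0.
  rewrite (_ : 0%E = P \d_x (~` lim_sup_set (fun n => X n @^-1` A))); last first.
    by rewrite probability_setC// io subee.
  apply: le_measure; rewrite ?inE; [exact: bigcapT_measurable|exact: measurableC|].
  move=> w av /(_ 1%N Logic.I)[r /= r1 Ar].
  by apply: (av r Logic.I r _ Ar); rewrite r1 /=.
rewrite -[X in _ --> X]null.
rewrite (_ : (fun m => escape Pi A m x) = P \d_x \o avoids X A 0); last first.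
  apply/funext => m /=; rewrite -[avoids _ _ _ _]setTI.
  have pT : past X 0 setT by rewrite -setC0; apply: pastC; exact: past0.
  rewrite (markov_avoids mA (Xmarkov \d_x) m pT).
  have -> : (\int[P \d_x]_w escape Pi A m (X 0%N w) =
     \int[pushforward (P \d_x) (X 0%N)]_y escape Pi A m y)%E.
    rewrite ge0_integral_pushforward ?preimage_setT//.
    - exact: measurable_escape.
    - by move=> y _; exact: escape_ge0.
  rewrite (eq_measure_integral \d_x).
    by rewrite integral_dirac//; [rewrite diracT mul1e|exact: measurable_escape].
  by move=> B mB _; exact: (Xmarkov \d_x).1.
apply: nonincreasing_cvg_mu => //.
- by rewrite ltey_eq fin_num_measure.
- exact: bigcapT_measurable.
- move=> m n mn; apply/subsetPset => w av r rm; apply: av.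
  by move: rm mn; clear; lia.
Qed.

(** * Tail factors and empirical frequencies *)

(** A monotone tail that vanishes somewhere vanishes from there on, and then the
ratio defining slow variation is 0, as [0^-1 = 0], instead of tending to 1. *)
Lemma slowly_varying_tail_gt0 (R : realType) (beta : R) (F : R -> R) :
  slowly_varying (tail_factor beta F) -> (forall x, 0 <= F x) ->
  (forall x y, 0 <= x <= y -> F y <= F x) -> forall x, 0 <= x -> 0 < F x.
Proof.
move=> slow F0 Fanti x x0; rewrite lt0r F0 andbT; apply/negP => /eqP Fx.
have ratio : \forall z \near +oo, 0 <
    tail_factor beta F (2 * z) / tail_factor beta F z.
  by apply: (cvgr_gt (1 : R)) => //; apply: slow.
have [z [xz]] := filter_ex (filterI (nbhs_pinfty_ge (num_real x)) ratio).
have Fz : F z = 0.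
  by apply/eqP; rewrite eq_le F0 andbT -Fx; apply: Fanti; rewrite x0.
by rewrite /tail_factor Fz mulr0 invr0 mulr0 ltxx.
Qed.

Lemma ln_tail_factor_ratio (R : realType) (beta : R) (F : R -> R) (k : R) :
  0 < F (expR k) -> 0 < F (expR (k + 1)) ->
  ln (tail_factor beta F (expR k) / tail_factor beta F (expR (k + 1))) =
  ln (F (expR k)) - ln (F (expR (k + 1))) - beta.
Proof.
move=> F0 F1; rewrite /tail_factor.
rewrite ln_div ?posrE ?mulr_gt0 ?powR_gt0 ?expR_gt0//.
by rewrite !lnM ?posrE ?powR_gt0 ?expR_gt0// !ln_powR !expRK; ring.
Qed.

(** The relative error [u] of the frequency [m^-1 * S] is at most [3 y], hence at
most [1 / 2], where [ln (1 + u)] is at most [2 |u|] in absolute value. *)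
Lemma log_frequency_error (R : realType) (a lambda p y m S : R) :
  0 < lambda -> 0 < p -> 0 < m -> y <= 1 / 40 -> a <= lambda * y * p * m ->
  `|S - m * p| < 3 * a / lambda ->
  0 < m^-1 * S /\ `|ln (m^-1 * S) - ln p| <= 6 * y.
Proof.
move=> l0 p0 m0 y40 ay dev.
have mp0 : 0 < m * p by rewrite mulr_gt0.
pose u := (S - m * p) / (m * p).
have uy : `|u| <= 3 * y.
  rewrite /u normrM normfV (gtr0_norm mp0) ler_pdivrMr//.
  apply/ltW/(lt_le_trans dev); rewrite ler_pdivrMr//.
  have -> : 3 * y * (m * p) * lambda = 3 * (lambda * y * p * m) by ring.
  by rewrite ler_pM2l.
have u12 : `|u| <= 1 / 2 by lra.
have SE : m^-1 * S = p * (1 + u).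
  by rewrite /u; field; rewrite (gt_eqF p0) (gt_eqF m0).
have u1 : 0 < 1 + u by move: u12; rewrite ler_norml => /andP[]; lra.
rewrite SE; split; first exact: mulr_gt0.
rewrite lnM ?posrE// addrAC subrr add0r.
by apply: le_trans (ln1D_norm_le u12) _; lra.
Qed.

(** * Measurability of the estimator *)

Section discrete_observables.
Context d (Omega : measurableType d).

(** Measurability with respect to the discrete sigma-algebra of the target: it is
inherited by every function of [f]. The estimator is a function of finitely many
counts of events. *)
Definition discrete_observable (T : Type) (f : Omega -> T) : Prop :=
  forall B : set T, measurable (f @^-1` B).

Lemma discrete_observable_pair (T U : countType) (f : Omega -> T) (g : Omega -> U) :
  discrete_observable f -> discrete_observable g ->
  discrete_observable (fun w => (f w, g w)).
Proof.
move=> mf mg B.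
rewrite (_ : _ @^-1` B = \bigcup_i (if unpickle i is Some t then
    f @^-1` [set t] `&` g @^-1` [set u | B (t, u)] else set0)).
  apply: bigcupT_measurable => i; case: unpickle => // t.
  by apply: measurableI; [exact: mf|exact: mg].
apply/seteqP; split => w /=.
  by move=> Bw; exists (pickle (f w)) => //; rewrite pickleK.
by move=> [i _]; case: unpickle => // t [/= -> ].
Qed.

Lemma discrete_observable_count (xi : nat -> Omega -> bool) (m n : nat) :
  (forall i, measurable [set w | xi i w]) ->
  discrete_observable (fun w => \sum_(m <= i < n) xi i w)%N.
Proof.
move=> mxi.
have bit i : discrete_observable (fun w => xi i w : nat).
  have obs : discrete_observable (xi i).
    move=> B; rewrite (_ : _ @^-1` B =
        ([set w | xi i w] `&` [set w | B true]) `|`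
        (~` [set w | xi i w] `&` [set w | B false])).
      have cst (Q : Prop) : measurable [set w : Omega | Q].
        have [q|nq] := pselect Q.
          by rewrite (_ : mkset _ = setT)//; apply/seteqP; split.
        by rewrite (_ : mkset _ = set0)//; apply/seteqP; split.
      by apply: measurableU; apply: measurableI => //; exact: measurableC.
    apply/seteqP; split => w /=.
      by case: (boolP (xi i w)) => xw Bw; [left|right]; split=> //; exact/negP.
    by move=> [[->]|[/negP/negbTE ->]].
  by move=> B; exact: (obs [set b : bool | B (nat_of_bool b)]).
elim: n => [|n IH].
  move=> B; rewrite (_ : (fun _ => _) = fun=> 0%N); last first.
    by apply/funext => w; rewrite big_geq.
  have [B0|nB0] := pselect (B 0%N).
    by rewrite (_ : _ @^-1` B = setT)//; apply/seteqP; split.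
  by rewrite (_ : _ @^-1` B = set0)//; apply/seteqP; split.
have [mn|nm] := leqP m n; last first.
  rewrite (_ : (fun _ => _) = fun w => (\sum_(m <= i < n) xi i w)%N)//.
  by apply/funext => w; rewrite !big_geq// ltnW.
move=> B; have := discrete_observable_pair IH (bit n).
move=> /(_ [set c : nat * nat | B (c.1 + c.2)%N]).
congr (measurable _); apply/funext => w /=.
by rewrite big_nat_recr.
Qed.

End discrete_observables.

Lemma p_hatE d (E : measurableType d) d' (Omega : measurableType d')
  (R : realType) (X : nat -> {mfun Omega >-> E}) A m (l : R) w :
  p_hat X A m l w =
  m%:R^-1 * (\sum_(0 <= i < m) exceedances X A (expR l) i w)%N%:R.
Proof. by rewrite /p_hat big_add1 /= natr_sum. Qed.

Section tail_monotone.
Context d (E : measurableType d) d' (Omega : measurableType d') (R : realType).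
Variables (X : nat -> {mfun Omega >-> E}) (A : set E) (Pr : probability Omega R).
Hypothesis mA : measurable A.

Lemma tail_le (x y : R) : 0 <= x <= y -> tail X A Pr y <= tail X A Pr x.
Proof.
move=> /andP[x0 xy]; have y0 := le_trans x0 xy.
rewrite !tail_avoids// fine_le ?fin_num_measure//; try exact: measurable_avoids.
apply: le_measure; rewrite ?inE; try exact: measurable_avoids.
move=> w av r /andP[r0 rx]; apply: av; rewrite r0/=.
by apply: leq_trans rx _; rewrite !add0n le_truncn.
Qed.

Lemma measurable_num_durations n (B : set nat) :
  measurable [set w | B (num_durations X A n w)].
Proof.
have mX i : measurable [set w | X i w \in A].
  rewrite (_ : mkset _ = X i @^-1` A); first exact: measurable_coord.
  by apply/seteqP; split => w; rewrite /= inE.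
exact: (discrete_observable_count 1 n.+1 mX [set s | B (s - 1)%N]).
Qed.

Lemma measurable_beta_hat_num_durations (n : nat) (k : R) (B : set R) :
  measurable [set w | B (beta_hat X A (num_durations X A n w) k w)].
Proof.
have mexc (l : R) i : measurable [set w | exceedances X A (expR l) i w].
  exact: (measurable_exceedances X mA i true (expR_ge0 l)).
rewrite (_ : mkset _ = \bigcup_m ([set w | num_durations X A n w = m] `&`
    [set w | B (beta_hat X A m k w)])); last first.
  apply/seteqP; split => w /=; first by move=> Bw; exists (num_durations X A n w).
  by move=> [m _ [/= ->]].
apply: bigcupT_measurable => m; apply: measurableI.
  exact: (measurable_num_durations n [set m]).
pose q (s : nat) : R := m%:R^-1 * s%:R.
have := discrete_observable_pair (discrete_observable_count 0 m (mexc k))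
  (discrete_observable_count 0 m (mexc (k + 1)))
  [set s | B (if 0 < q s.2 then ln (q s.1 / q s.2) else 0)].
by congr measurable; apply/funext => w; rewrite /= /beta_hat !p_hatE.
Qed.

End tail_monotone.

(** * The deviation bound *)

Theorem proposition3p4 (R : realType)
  (d : measure_display) (E : measurableType d)
  (d' : measure_display) (Omega : measurableType d')
  (Pi : R.-pker E ~> E) (psi : {measure set E -> \bar R})
  (X : nat -> {mfun Omega >-> E})
  (P : probability E R -> probability Omega R)
  (A : set E) (alpha nu : probability E R)
  (d'' : measure_display) (T : measurableType d'') (Q : probability T R)
  (beta : R) (M : {RV Q >-> R})
  (delta Hdelta Rdelta : R) (ndelta n : nat) (k : R)
  (E_cg : countably_generated E)
  (X_markov : forall mu, markov_chain (P mu) X Pi mu)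
  (X_irr : psi_irreducible Pi psi)
  (X_aper : aperiodic Pi psi)
  (X_harris : harris_recurrent X P psi)
  (A_atom : accessible_atom Pi psi A)
  (alphaA : alpha A = 1%E)
  (beta01 : 0 < beta < 1)
  (M_ML : mittag_leffler beta M)
  (delta_bounds : 0 < delta < 1 / 2)
  (HR : 0 < Rdelta < Hdelta) :
  let PA := P alpha in
  let Fbar := tail X A PA in
  let L := tail_factor beta Fbar in
  let p := fun l : R => Fbar (expR l) in
  let N := num_durations X A in
  let v := ln (36 / delta) * Fbar n%:R / Hdelta in
  beta_regular beta Fbar ->
  ((1 - delta / 2)%:E <=
     Q [set w | (Rdelta <= M w / Gamma (1 - beta) <= Hdelta)%R])%E ->
  (forall m : nat, (ndelta <= m)%N ->
    ((1 - delta)%:E <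
       P nu [set w |
         (Rdelta / Fbar m%:R <= (N m w)%:R <= Hdelta / Fbar m%:R)%R])%E) ->
  (ndelta <= n)%N ->
  (40 * Hdelta * Rdelta^-1) ^+ 2 * v <= p (k + 1) ->
  ((1 - 2 * delta)%:E <
     P nu [set w | (`|beta_hat X A (N n w) k w - beta| <=
       60 * Hdelta / Rdelta * Num.sqrt (v / p (k + 1)) +
       `|ln (L (expR k) / L (expR (k + 1)))|)%R])%E.

Proof.
move=> PA Fbar L p N v regular _ N_bounds n_ge p_ge.
have [mA psiA atom] := A_atom.
have [/andP[d0 d12] /andP[R0 RH]] := (delta_bounds, HR).
have H0 : 0 < Hdelta := lt_trans R0 RH.
have [a0 Aa0] : A !=set0.
  apply/set0P/eqP => A0; move: alphaA; rewrite A0 measure0 => /eqP.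
  by rewrite eqe eq_sym oner_eq0.
have atom0 y : A y -> forall B, measurable B -> Pi y B = Pi a0 B.
  by move=> Ay; exact: atom.
have Fbar0 x : 0 <= x -> 0 < Fbar x.
  apply: (slowly_varying_tail_gt0 regular) => [y|x' y]; first exact: fine_ge0.
  exact: tail_le.
have esc0 := harris_escape_cvg0 X_markov X_harris mA psiA.
have trials l : bernoulli_trials (P nu) (exceedances X A (expR l)) (p l).
  rewrite /p /Fbar (atom_tail mA (X_markov alpha) atom0 alphaA (expR_ge0 l)).
  exact: (exceedances_bernoulli_trials mA (X_markov nu) atom0 esc0 (expR_ge0 l)).
have p0 l : 0 < p l by apply: Fbar0; exact: expR_ge0.
have p01 l : 0 <= p l <= 1.
  rewrite ltW//= /p /Fbar tail_avoids ?expR_ge0// -lee_fin.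
  have mav := measurable_avoids X mA 0 (Num.truncn (expR l)).
  by rewrite fineK ?fin_num_measure// probability_le1.
set F := Fbar n%:R in v p_ge *.
have F0 : 0 < F by exact: Fbar0.
pose a := ln (36 / delta).
have a0' : 0 < a by rewrite /a ln_gt0// ltr_pdivlMr//; lra.
have v0 : 0 < v by rewrite /v divr_gt0// mulr_gt0.
have expa : 2 * expR (- a) = delta / 18.
  by rewrite expRN /a lnK ?posrE ?divr_gt0//; field; rewrite gt_eqF.
have p_le : p (k + 1) <= p k.
  by apply: tail_le => //; rewrite expR_ge0 /= ler_expR lerDl ler01.
(* With this lambda the drift m p lambda^2 is at most a for m <= H / Fbar n. *)
pose lam l := Num.sqrt (v / p l).
pose y l := lam l * (Hdelta / Rdelta).
have lam0 l : 0 < lam l by rewrite sqrtr_gt0 divr_gt0.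
have lam2 l : lam l ^+ 2 * p l = v.
  have vp : 0 <= v / p l by rewrite ltW// divr_gt0.
  by rewrite sqr_sqrtr// divfK// gt_eqF.
have HR0 : 0 < Hdelta / Rdelta by rewrite divr_gt0.
(* The lower bound on p (k + 1), read as a bound on y (k + 1). *)
have y1_le : y (k + 1) <= 1 / 40.
  rewrite -ler_sqr ?nnegrE//; last by rewrite mulr_ge0// ltW.
  rewrite exprMn -(ler_pM2r (p0 (k + 1))) mulrAC lam2.
  move: p_ge; rewrite exprMn exprMn -/(Hdelta / Rdelta).
  have := sqr_ge0 (Hdelta / Rdelta); rewrite exprMn; lra.
have y_le : y k <= y (k + 1).
  by rewrite ler_pM2r// ler_wsqrtr// ler_pM2l// lef_pV2// posrE.
have HR1 : 1 < Hdelta / Rdelta by rewrite ltr_pdivlMr// mul1r.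
have lam_le l : y l <= 1 / 40 -> 0 < lam l <= 1 / 2.
  by rewrite lam0 /= /y; have := lam0 l; nra.
pose h := Num.truncn (Hdelta / F).
have hE : h%:R <= Hdelta / F by rewrite truncn_le divr_ge0// ltW.
have dev l : y l <= 1 / 40 ->
    exists2 B : set Omega, measurable B /\ (P nu B <= (delta / 18)%:E)%E &
    forall w, ~ B w -> forall m : nat, Rdelta / F <= m%:R <= Hdelta / F ->
      0 < p_hat X A m l w /\ `|ln (p_hat X A m l w) - ln (p l)| <= 6 * y l.
  move=> yl; have hla : h%:R * p l * lam l ^+ 2 <= a.
    have -> : h%:R * p l * lam l ^+ 2 = h%:R * v by rewrite -(lam2 l); ring.
    apply: le_trans (_ : Hdelta / F * v <= _).
      by rewrite ler_wpM2r// ltW.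
    by rewrite /v /a le_eqVlt; apply/orP; left; apply/eqP; field;
      rewrite !gt_eqF.
  have [B [mB PB] hB] := bernoulli_deviation (trials l) (p01 l) (lam_le l yl) hla.
  exists B; first by rewrite -expa.
  move=> w nB m /andP[Rm mH].
  have mh : (m <= h)%N by rewrite truncn_ge_nat// divr_ge0// ltW.
  have m0 : 0 < m%:R :> R by apply: lt_le_trans Rm; rewrite divr_gt0.
  rewrite p_hatE natr_sum.
  apply: (log_frequency_error (lam0 l) (p0 l) m0 yl) (hB w nB m mh).
  have -> : lam l * y l * p l * m%:R = lam l ^+ 2 * p l * (Hdelta / Rdelta) * m%:R.
    by rewrite /y; ring.
  rewrite lam2; apply: le_trans (_ : v * (Hdelta / Rdelta) * (Rdelta / F) <= _).
    rewrite /v -/a le_eqVlt; apply/orP; left; apply/eqP; field.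
    by rewrite !gt_eqF.
  by rewrite ler_wpM2l// mulr_ge0 ?(ltW v0)// ltW.
have [B1 [mB1 PB1] dev1] := dev _ y1_le.
have [B0 [mB0 PB0] dev0] := dev _ (le_trans y_le y1_le).
set G := [set w | (Rdelta / F <= (N n w)%:R <= Hdelta / F)%R].
set T' := [set w | _].
have mT' : measurable T'.
  have mbeta := measurable_beta_hat_num_durations X mA n k.
  exact (mbeta [set b | `|b - beta| <=
    60 * Hdelta / Rdelta * Num.sqrt (v / p (k + 1)) +
    `|ln (L (expR k) / L (expR (k + 1)))|]).
have mG : measurable G.
  exact: (measurable_num_durations X mA n
    [set m : nat | Rdelta / F <= m%:R <= Hdelta / F]).
(* Pathwise part: off B0 and B1 the bound holds whatever N in the window. *)
have GT : G `<=` T' `|` (B0 `|` B1).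
  move=> w Gw; have [Bw|/not_orP[nB0 nB1]] := pselect ((B0 `|` B1) w).
    by right.
  left; have [ph0 lnk] := dev0 w nB0 (N n w) Gw.
  have [ph1 lnk1] := dev1 w nB1 (N n w) Gw.
  rewrite /T' /= /beta_hat ph1 ln_div ?posrE//.
  rewrite (ln_tail_factor_ratio beta (p0 k) (p0 (k + 1))) -/(p k) -/(p (k + 1)).
  set b0 := ln (p_hat _ _ _ k _) in lnk *; set b1 := ln (p_hat _ _ _ _ _) in lnk1 *.
  have -> : b0 - b1 - beta = (b0 - ln (p k)) - (b1 - ln (p (k + 1))) +
      (ln (p k) - ln (p (k + 1)) - beta) by ring.
  apply: le_trans (ler_normD _ _) _; rewrite lerD2r.
  apply: le_trans (ler_normB _ _) _.
  have -> : 60 * Hdelta / Rdelta * Num.sqrt (v / p (k + 1)) = 60 * y (k + 1).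
    by rewrite /y /lam; ring.
  have y0 : 0 <= y (k + 1) by rewrite mulr_ge0// ltW.
  by lra.
have PG : ((1 - delta)%:E < P nu G)%E by exact: N_bounds.
have : (P nu G <= P nu T' + (delta / 9)%:E)%E.
  have mB : measurable (B0 `|` B1) by exact: measurableU.
  apply: le_trans (_ : P nu (T' `|` (B0 `|` B1)) <= _)%E.
    by apply: le_measure; rewrite ?inE//; exact: measurableU.
  apply: le_trans (measureU2 _ mT' mB) _; rewrite leeD2l//.
  apply: le_trans (measureU2 _ mB0 mB1) _.
  rewrite (_ : delta / 9 = delta / 18 + delta / 18); last by field.
  by rewrite EFinD leeD.
move=> /(lt_le_trans PG).
rewrite -(fineK (fin_num_measure (P nu) _ mT')) -EFinD !lte_fin.
lra.
Qed.
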